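(* Let $g\in L^2(\mathbb{R})$, $a,b>0$ and $c\in\mathbb{R}$ be such that the Gabor system $\mathcal{G}(g,a,b)=\{E_b^mT_a^ng\}_{m,n\in\mathbb{Z}}$ is an overcomplete frame of $L^2(\mathbb{R})$ and $\operatorname{supp}(g)=[c,c+a]$. Then, regardless of the ordering over $\mathbb{Z}$, $\mathcal{G}(g,a,b)$ is not generated by an operator in $GL(L^2(\mathbb{R}))$; that is, for every bijection $\sigma:\mathbb{Z}\to\mathbb{Z}\times\mathbb{Z}$, writing $f_k:=E_b^{m}T_a^{n}g$ with $(m,n)=\sigma(k)$, there is no $T\in GL(L^2(\mathbb{R}))$ with $f_k=T^kf_0$ for all $k\in\mathbb{Z}$.
   Context: For $a,b\in\mathbb{R}$, the translation and modulation operators on $L^2(\mathbb{R})$ are $(T_af)(x)=f(x-a)$ and $(E_bf)(x)=e^{2\pi i bx}f(x)$. For a separable Hilbert space $\mathcal{H}$, $GL(\mathcal{H})$ is the set of bounded linear operators $T:\mathcal{H}\to\mathcal{H}$ that are bijective (hence with bounded inverse). A countable family $\{f_n\}_{n\in J}$ in $\mathcal{H}$ is a frame if there exist $A,B>0$ with $A\|f\|^2\le\sum_{n\in J}|\langle f,f_n\rangle|^2\le B\|f\|^2$ for all $f\in\mathcal{H}$. Its synthesis operator is $U:\ell_2(J)\to\mathcal{H}$, $U\{c_n\}=\sum_{n\in J}c_nf_n$. A frame is a Riesz basis if $\ker U=\{0\}$, and is overcomplete if it is not a Riesz basis. *)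

(* Defs.v *)
From HB Require Import structures.
From mathcomp Require Import all_boot all_order all_algebra generic_quotient.
From mathcomp Require Import sesquilinear finmap complex.
From mathcomp Require Import ring lra.
From mathcomp Require Import all_classical all_reals all_analysis.
From mathcomp Require Import measurable_realfun.

Set Implicit Arguments.
Unset Strict Implicit.
Unset Printing Implicit Defensive.

Import Order.TTheory GRing.Theory Num.Theory.
Import numFieldNormedType.Exports.

Local Open Scope complex_scope.
Local Open Scope classical_set_scope.
Local Open Scope ring_scope.

Local Notation Re := (@complex.Re _).
Local Notation Im := (@complex.Im _).
Local Notation normc := (@Normc.normc _).

Section frames.
Context (R : realType) (H : lmodType R[i]) (dot : {dot H for @conjc R}).

Definition hnorm (u : H) : R := Num.sqrt (Re (dot u u)).

(* Unconditional summation: convergence of the net of finite partial sums. *)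
Definition has_sum (J : choiceType) (u : J -> H) (s : H) : Prop :=
  forall e : R, 0 < e -> exists F0 : {fset J}, forall F : {fset J},
    (F0 `<=` F)%fset -> hnorm (\sum_(j <- F) u j - s) < e.

Definition in_ell2 (J : choiceType) (c : J -> R[i]) : Prop :=
  (\esum_(j in [set: J]) (normc (c j) ^+ 2)%:E < +oo)%E.

Definition frame (J : countType) (f : J -> H) : Prop :=
  exists A B : R, [/\ 0 < A, 0 < B & forall h : H,
    ((A * hnorm h ^+ 2)%:E
      <= \esum_(j in [set: J]) (normc (dot h (f j)) ^+ 2)%:E
      <= (B * hnorm h ^+ 2)%:E)%E].

(* The graph of the synthesis operator on l2(J): [synthesis f c h] reads
   U c = h. *)
Definition synthesis (J : countType) (f : J -> H) (c : J -> R[i]) (h : H) :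
    Prop :=
  in_ell2 c /\ has_sum (fun j => c j *: f j) h.

Definition riesz_basis (J : countType) (f : J -> H) : Prop :=
  frame f /\ forall c, synthesis f c 0 -> forall j, c j = 0.

Definition overcomplete_frame (J : countType) (f : J -> H) : Prop :=
  frame f /\ ~ riesz_basis f.

Definition bounded_operator (T : H -> H) : Prop :=
  exists M : R, forall h, hnorm (T h) <= M * hnorm h.

Definition in_GL (T : {linear H -> H}) : Prop :=
  bounded_operator T /\ bijective T.

(* The integer power T^k of a bijection T, negative powers being those of its
   inverse; for T not bijective, negative powers are junk. *)
Definition opz (T : H -> H) (k : int) (h : H) : H :=
  match k with
  | Posz n => iter n T h
  | Negz n => iter n.+1 ('pinv_(fun=> 0) setT T) h
  end.

Definition generated_by (T : H -> H) (f : int -> H) : Prop :=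
  forall k : int, f k = opz T k (f 0).

Lemma opz_can (T S : H -> H) : cancel T S -> cancel S T ->
  forall k h, opz T k h =
    if k is Negz n then iter n.+1 S h else iter `|k|%N T h.
Proof.
move=> TK SK [//|n] h /=.
suff -> : 'pinv_(fun=> 0) setT T = S by [].
apply/funext => x; rewrite -{1}[x]SK; apply: pinvKV; rewrite ?inE//.
by move=> y z _ _ /(congr1 S); rewrite !TK.
Qed.

End frames.

Section sqint.
Context {R : realType}.
Local Notation mu := (@lebesgue_measure R).

Lemma lebesgue_aeS (P Q : R -> Prop) : (forall x, P x -> Q x) ->
  (\forall x \ae mu, P x) -> \forall x \ae mu, Q x.
Proof.
by move=> PQ; apply: filterS PQ; exact: (ae_filter_ringOfSetsType mu).
Qed.

Lemma lebesgue_aeS2 (P Q S : R -> Prop) : (forall x, P x -> Q x -> S x) ->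
  (\forall x \ae mu, P x) -> (\forall x \ae mu, Q x) -> \forall x \ae mu, S x.
Proof.
by move=> PQS; apply: filterS2 PQS; exact: (ae_filter_ringOfSetsType mu).
Qed.

Lemma lebesgue_aeW (P : R -> Prop) : (forall x, P x) -> \forall x \ae mu, P x.
Proof. by move=> PT; apply: nearW PT; exact: (ae_filter_ringOfSetsType mu). Qed.

Definition sqint : {pred R -> R[i]} := fun f =>
  `[< [/\ measurable_fun setT (Re \o f), measurable_fun setT (Im \o f)
        & (\int[mu]_x (normc (f x) ^+ 2)%:E < +oo)%E] >].

Lemma normc_sqr (z : R[i]) : normc z ^+ 2 = Re z ^+ 2 + Im z ^+ 2.
Proof. by case: z => a b /=; rewrite sqr_sqrtr// addr_ge0// sqr_ge0. Qed.

Lemma measurable_normc_sqr (f : R -> R[i]) :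
  measurable_fun setT (Re \o f) -> measurable_fun setT (Im \o f) ->
  measurable_fun setT (fun x => normc (f x) ^+ 2).
Proof.
move=> mr mi; under eq_fun do rewrite normc_sqr.
by apply: measurable_funD; apply: measurable_funX.
Qed.

Lemma sqint_le (f : R -> R[i]) (h : R -> R) (k : R):
  measurable_fun setT (Re \o f) -> measurable_fun setT (Im \o f) ->
  mu.-integrable setT (EFin \o h) ->
  (forall x, normc (f x) ^+ 2 <= k * h x) -> f \in sqint.
Proof.
move=> mr mi ih fh; apply/asboolP; split=> //.
have mf := measurable_normc_sqr mr mi.
have /integrableP[_] : mu.-integrable setT
    (fun x => (normc (f x) ^+ 2)%:E).
  apply: (le_integrable measurableT _ _ (integrableZl measurableT k ih)).
    exact/measurable_EFinP.
  move=> x _ /=; rewrite lee_fin (ger0_norm (sqr_ge0 _)).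
  exact: le_trans (fh x) (ler_norm _).
under eq_integral => x _ do rewrite /= (ger0_norm (sqr_ge0 _)).
by [].
Qed.

Lemma sqint_integrable f : f \in sqint ->
  mu.-integrable setT (EFin \o (fun x => normc (f x) ^+ 2)).
Proof.
move=> /asboolP[mr mi fi]; apply/integrableP; split.
  by apply/measurable_EFinP; apply: measurable_normc_sqr.
under eq_integral => x _ do rewrite /= (ger0_norm (sqr_ge0 _)).
by [].
Qed.

Lemma sqint_submod_closed : submod_closed sqint.
Proof.
split.
  apply/asboolP; split.
  - exact: (@measurable_cst _ _ _ _ setT (0 : R)).
  - exact: (@measurable_cst _ _ _ _ setT (0 : R)).
  by rewrite integral0_eq// => x _; rewrite normc_sqr/= expr0n/= addr0.
move=> a f g /[dup] /asboolP[mrf mif _] /sqint_integrable If.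
move=> /[dup] /asboolP[mrg mig _] /sqint_integrable Ig.
have If' := integrableZl measurableT (2 * normc a ^+ 2) If.
have Ig' := integrableZl measurableT 2 Ig.
apply: (@sqint_le _ (fun x => 2 * normc a ^+ 2 * normc (f x) ^+ 2
  + 2 * normc (g x) ^+ 2) 1).
- have -> : Re \o (a *: f + g) =
      (fun x => Re a * Re (f x) - Im a * Im (f x) + Re (g x)).
    apply/funext => x /=; rewrite /GRing.add/= /GRing.scale/=.
    by case: {If'} a (f x) (g x) => [? ?] [? ?] [? ?].
  apply: measurable_funD => //; apply: measurable_funB; exact: measurable_funM.
- have -> : Im \o (a *: f + g) =
      (fun x => Re a * Im (f x) + Im a * Re (f x) + Im (g x)).
    apply/funext => x /=; rewrite /GRing.add/= /GRing.scale/=.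
    by case: {If'} a (f x) (g x) => [? ?] [? ?] [? ?].
  apply: measurable_funD => //; apply: measurable_funD; exact: measurable_funM.
- exact: (integrableD measurableT If' Ig').
- move=> x; rewrite mul1r.
  have -> : (a *: f + g) x = a * f x + g x by [].
  rewrite -mulrA -exprMn -Normc.normcM; move: (a * f x) (g x) => [p q] [r s].
  rewrite !normc_sqr /= -mulrDr -subr_ge0.
  have -> : 2 * (p ^+ 2 + q ^+ 2 + (r ^+ 2 + s ^+ 2)) -
    ((p + r) ^+ 2 + (q + s) ^+ 2) = (p - r) ^+ 2 + (q - s) ^+ 2 by ring.
  by rewrite addr_ge0// sqr_ge0.
Qed.

HB.instance Definition _ :=
  GRing.isSubmodClosed.Build R[i] (R -> R[i]) sqint sqint_submod_closed.


Definition Cintegral (h : R -> R[i]) : R[i] :=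
  (\int[mu]_x Re (h x))%R +i* (\int[mu]_x Im (h x))%R.

Definition Cintegrable (h : R -> R[i]) : Prop :=
  mu.-integrable setT (EFin \o (fun x => Re (h x))) /\
  mu.-integrable setT (EFin \o (fun x => Im (h x))).

Lemma CintegralD f g : Cintegrable f -> Cintegrable g ->
  Cintegral (fun x => f x + g x) = Cintegral f + Cintegral g.
Proof.
move=> [fr fi] [gr gi]; rewrite /Cintegral.
rewrite -[RHS]/(_ +i* _) -!RintegralD//.
by congr (_ +i* _); apply: eq_Rintegral => x _; case: (f x) (g x) => ? ? [].
Qed.

Lemma CintegralZ a f : Cintegrable f ->
  Cintegral (fun x => a * f x) = a * Cintegral f.
Proof.
move=> [fr fi]; rewrite /Cintegral; case: a => p q.
rewrite -[RHS]/(_ +i* _) -!RintegralZl//.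
have Z k (h : R -> R) : mu.-integrable setT (EFin \o h) ->
    mu.-integrable setT (EFin \o (fun x => k * h x)).
  by move=> ih; exact: (integrableZl measurableT k ih).
rewrite -RintegralB//; [|exact: Z..].
rewrite -RintegralD//; [|exact: Z..].
by congr (_ +i* _); apply: eq_Rintegral => x _; case: (f x).
Qed.

Lemma Cintegral_conj f : Cintegrable f ->
  Cintegral (fun x => conjc (f x)) = conjc (Cintegral f).
Proof.
move=> [fr fi]; rewrite /Cintegral -[RHS]/(_ +i* _); congr (_ +i* _).
  by apply: eq_Rintegral => x _; case: (f x).
rewrite -mulN1r -RintegralZl//; apply: eq_Rintegral => x _.
by rewrite mulN1r; case: (f x).
Qed.

Lemma ae_eq_Cintegral f g : Cintegrable f -> Cintegrable g ->
  (\forall x \ae mu, f x = g x) -> Cintegral f = Cintegral g.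
Proof.
move=> [fr fi] [gr gi] fg; rewrite /Cintegral /Rintegral.
congr (fine _ +i* fine _); apply: ae_eq_integral => //.
- exact: measurable_int fr.
- exact: measurable_int gr.
- by apply: lebesgue_aeS fg => x -> _.
- exact: measurable_int fi.
- exact: measurable_int gi.
- by apply: lebesgue_aeS fg => x -> _.
Qed.

Lemma sqint_conj_integrable f g : f \in sqint -> g \in sqint ->
  Cintegrable (fun x => f x * conjc (g x)).
Proof.
move=> /[dup] /asboolP[mrf mif _] /sqint_integrable If.
move=> /[dup] /asboolP[mrg mig _] /sqint_integrable Ig.
have I2 := integrableD measurableT If Ig.
split; apply: le_integrable I2 => //.
- apply/measurable_EFinP.
  have -> : (fun x => Re (f x * conjc (g x))) =
      (fun x => Re (f x) * Re (g x) + Im (f x) * Im (g x)).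
    apply/funext => x; case: (f x) (g x) => [p q] [r s] /=.
    by rewrite mulrN opprK.
  by apply: measurable_funD; exact: measurable_funM.
- move=> x _; rewrite /= lee_fin; case: (f x) (g x) => [p q] [r s].
  rewrite !normc_sqr/= [leRHS]ger0_norm ?addr_ge0 ?sqr_ge0//.
  have := sqr_ge0 (p - r).
  have := sqr_ge0 (p + r).
  have := sqr_ge0 (q - s).
  have := sqr_ge0 (q + s).
  move: (sqr_ge0 p) (sqr_ge0 q) (sqr_ge0 r) (sqr_ge0 s) => *.
  by rewrite ler_norml; apply/andP; split; nra.
- apply/measurable_EFinP.
  have -> : (fun x => Im (f x * conjc (g x))) =
      (fun x => Im (f x) * Re (g x) - Re (f x) * Im (g x)).
    apply/funext => x; case: (f x) (g x) => [p q] [r s] /=.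
    by rewrite mulrN addrC.
  by apply: measurable_funB; exact: measurable_funM.
- move=> x _; rewrite /= lee_fin; case: (f x) (g x) => [p q] [r s].
  rewrite !normc_sqr/= [leRHS]ger0_norm ?addr_ge0 ?sqr_ge0//.
  have := sqr_ge0 (p - s).
  have := sqr_ge0 (p + s).
  have := sqr_ge0 (q - r).
  have := sqr_ge0 (q + r).
  move: (sqr_ge0 p) (sqr_ge0 q) (sqr_ge0 r) (sqr_ge0 s) => *.
  by rewrite ler_norml; apply/andP; split; nra.
Qed.

End sqint.

Section L2.
Context (R : realType).
Local Notation mu := (@lebesgue_measure R).

Record L2fun := L2Fun { l2fun :> R -> R[i]; l2funP : l2fun \in sqint }.

HB.instance Definition _ := [isSub for l2fun].
HB.instance Definition _ := [Choice of L2fun by <:].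
HB.instance Definition _ := [SubChoice_isSubLmodule of L2fun by <:].

Definition nullfun : {pred L2fun} :=
  fun f => `[< \forall x \ae mu, f x = 0 >].

Lemma nullfun_submod_closed : submod_closed nullfun.
Proof.
split; first by apply/asboolP; apply: lebesgue_aeW.
move=> a f g /asboolP f0 /asboolP g0; apply/asboolP.
apply: lebesgue_aeS2 f0 g0 => x fx gx.
have -> : (a *: f + g) x = a * f x + g x by [].
by rewrite fx gx mulr0 addr0.
Qed.

HB.instance Definition _ :=
  GRing.isSubmodClosed.Build R[i] L2fun nullfun nullfun_submod_closed.

Local Open Scope quotient_scope.

Definition L2 : Type := {ideal_quot nullfun}.
HB.instance Definition _ := GRing.Zmodule.on L2.
HB.instance Definition _ := EqQuotient.on L2.

Definition L2class (f : L2fun) : L2 := \pi_{ideal_quot nullfun} f.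
Definition L2rep (f : L2) : L2fun := repr f.

Lemma L2repK : cancel L2rep L2class.
Proof. exact: reprK. Qed.

Lemma L2classE f g :
  L2class f = L2class g <-> \forall x \ae mu, f x = g x.
Proof.
split=> [/eqP|fg].
  rewrite -Quotient.idealrBE => /asboolP; apply: lebesgue_aeS => x.
  have -> : (f - g) x = f x - g x by [].
  by move/eqP; rewrite subr_eq0 => /eqP.
apply/eqP; rewrite -Quotient.idealrBE; apply/asboolP.
apply: lebesgue_aeS fg => x fg; have -> : (f - g) x = f x - g x by [].
by rewrite fg subrr.
Qed.

Lemma L2rep_class f : \forall x \ae mu, L2rep (L2class f) x = f x.
Proof. by apply/L2classE; rewrite L2repK. Qed.

Lemma L2class_is_zmod_morphism : zmod_morphism L2class.
Proof. by move=> f g; rewrite /L2class raddfB. Qed.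

HB.instance Definition _ :=
  GRing.isZmodMorphism.Build L2fun L2 L2class L2class_is_zmod_morphism.

Definition L2scale (a : R[i]) (f : L2) : L2 :=
  L2class (a *: L2rep f).

Lemma L2scale_class a f : L2scale a (L2class f) = L2class (a *: f).
Proof.
apply/L2classE; apply: lebesgue_aeS (L2rep_class f) => x fx.
have E (h : L2fun) : (a *: h) x = a * h x by [].
by rewrite !E fx.
Qed.

Fact L2scaleA a b f : L2scale a (L2scale b f) = L2scale (a * b) f.
Proof. by rewrite -[f]L2repK !L2scale_class scalerA. Qed.
Fact L2scale1 : left_id 1 L2scale.
Proof. by move=> f; rewrite -[f]L2repK L2scale_class scale1r. Qed.
Fact L2scaleDr : right_distributive L2scale +%R.
Proof.
move=> a f g; rewrite -[f]L2repK -[g]L2repK -raddfD !L2scale_class.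
by rewrite scalerDr raddfD.
Qed.
Fact L2scaleDl f : {morph L2scale^~ f : a b / a + b}.
Proof.
by move=> a b; rewrite -[f]L2repK !L2scale_class scalerDl raddfD.
Qed.
HB.instance Definition _ := GRing.Zmodule_isLmodule.Build R[i] L2
  L2scaleA L2scale1 L2scaleDr L2scaleDl.

Lemma L2class_is_scalable : scalable L2class.
Proof. by move=> a f; rewrite -L2scale_class. Qed.
HB.instance Definition _ :=
  GRing.isScalable.Build R[i] L2fun L2 *:%R L2class L2class_is_scalable.

Definition L2dot (f g : L2) : R[i] :=
  Cintegral (fun x => L2rep f x * conjc (L2rep g x)).

Lemma L2dot_class (f g : L2fun) :
  L2dot (L2class f) (L2class g) = Cintegral (fun x => f x * conjc (g x)).
Proof.
apply: ae_eq_Cintegral; [by apply: sqint_conj_integrable; exact: l2funP..|].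
by apply: lebesgue_aeS2 (L2rep_class f) (L2rep_class g) => x -> ->.
Qed.

Lemma L2dotC f g : L2dot f g = conjc (L2dot g f).
Proof.
rewrite /L2dot -Cintegral_conj; last first.
  by apply: sqint_conj_integrable; exact: l2funP.
by congr Cintegral; apply/funext => x; rewrite rmorphM/= conjcK mulrC.
Qed.

Lemma L2dot_linearl g : scalar (L2dot^~ g).
Proof.
move=> a f1 f2; rewrite -[f1]L2repK -[f2]L2repK -[g]L2repK -linearP.
have I (f : L2fun) : Cintegrable (fun x => f x * conjc (L2rep g x)).
  by apply: sqint_conj_integrable; exact: l2funP.
rewrite !L2dot_class -CintegralZ// -CintegralD//; last first.
  rewrite (_ : (fun x => _) =
    fun x => (a *: L2rep f1) x * conjc (L2rep g x)); first exact: I.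
  by apply/funext => x; rewrite mulrA.
congr Cintegral; apply/funext => x.
have -> : (a *: L2rep f1 + L2rep f2) x = a * L2rep f1 x + L2rep f2 x by [].
by rewrite mulrDl mulrA.
Qed.

Lemma L2dot_bilinear : bilinear_for *%R (@conjc R \; *%R) L2dot.
Proof.
split=> u; first exact: L2dot_linearl.
move=> a f g; rewrite [LHS]L2dotC L2dot_linearl rmorphD rmorphM/=.
by rewrite (L2dotC u f) (L2dotC u g).
Qed.

HB.instance Definition _ := bilinear_isBilinear.Build R[i] L2 L2 R[i]
  *%R (@conjc R \; *%R) L2dot L2dot_bilinear.

Lemma L2dot_hermitian f g : L2dot f g = (-1) ^+ false * conjc (L2dot g f).
Proof. by rewrite expr0 mul1r L2dotC. Qed.

HB.instance Definition _ := isHermitianSesquilinear.Build R[i] L2 false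
  (@conjc R) L2dot L2dot_hermitian.

Lemma L2dot_gt0 f : f != 0 -> 0 < L2dot f f.
Proof.
move=> f0; have Ig := sqint_integrable (l2funP (L2rep f)).
have E : L2dot f f = (\int[mu]_x (normc (L2rep f x) ^+ 2))%R +i* 0.
  rewrite /L2dot /Cintegral; congr (_ +i* _).
    apply: eq_Rintegral => x _; rewrite normc_sqr.
    by case: (L2rep f x) => p q /=; rewrite mulrN opprK.
  rewrite /Rintegral integral0_eq// => x _; congr EFin.
  by case: (L2rep f x) => p q /=; rewrite mulrN addrC mulrC subrr.
rewrite E ltcE/= eqxx/= lt_neqAle Rintegral_ge0 ?andbT; last first.
  by move=> x _; exact: sqr_ge0.
apply: contra f0 => /eqP i0.
have n0 : (\int[mu]_x (normc (L2rep f x) ^+ 2)%:E = 0)%E.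
  rewrite -[LHS]fineK; last exact: (integrable_fin_num measurableT Ig).
  by rewrite -[fine _]/(\int[mu]_x (normc (L2rep f x) ^+ 2))%R -i0.
apply/eqP; rewrite -[f]L2repK -(raddf0 L2class); apply/L2classE.
have /ae_eq_integral_abs : measurable_fun [set: measurableTypeR R]
    (EFin \o (fun x => normc (L2rep f x) ^+ 2)) by exact: measurable_int Ig.
move=> /(_ mu measurableT)[+ _]; under eq_integral => x _.
  rewrite /= (ger0_norm (sqr_ge0 _)); over.
move=> /(_ n0); apply: lebesgue_aeS => x /(_ I) [] /eqP.
by rewrite sqrf_eq0 => /eqP /Normc.eq0_normc.
Qed.

HB.instance Definition _ := isDotProduct.Build R[i] L2 L2dot L2dot_gt0.

(* The support of an L^2 class: the complement of the largest open set on
   which it vanishes almost everywhere. *)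
Definition L2supp (f : L2) : set R :=
  [set x | forall U : set R, nbhs x U ->
     ~ \forall y \ae mu, U y -> L2rep f y = 0].

Definition rshift (a : R) : measurableTypeR R -> measurableTypeR R :=
  fun x => x - a.

Lemma measurable_rshift a : measurable_fun setT (rshift a).
Proof. by apply: measurable_funB. Qed.

Lemma lebesgue_measure_rshift a (A : set (measurableTypeR R)) : measurable A ->
  pushforward mu (rshift a) A = mu A.
Proof.
move=> mA; apply/esym/lebesgue_measure_unique => //=.
  exact: measurable_rshift.
move=> ? _ [[p q]] _ <-; rewrite /pushforward.
have -> : rshift a @^-1` `]p, q]%classic = `]p + a, q + a]%classic.
  by apply/seteqP; split=> x /=; rewrite !in_itv/= /rshift ltrBrDr lerBlDr.
rewrite !lebesgue_measure_itv/= !lte_fin ltrD2r.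
by case: ifP => // _; rewrite -!EFinB; congr EFin; ring.
Qed.

Lemma ae_rshift a (P : R -> Prop) :
  (\forall x \ae mu, P x) -> \forall x \ae mu, P (x - a).
Proof.
move=> [N [mN N0 PN]]; exists (rshift a @^-1` N); split.
- by rewrite -[X in measurable X]setTI; exact: measurable_rshift.
- by move: (lebesgue_measure_rshift a mN); rewrite /pushforward N0.
- by move=> x; exact: PN.
Qed.

Lemma sqint_transl a (f : L2fun) : (fun x => f (x - a)) \in sqint.
Proof.
have /asboolP[mr mi fi] := l2funP f; apply/asboolP; split.
- exact: (measurableT_comp mr (measurable_rshift a)).
- exact: (measurableT_comp mi (measurable_rshift a)).
- rewrite -[X in (X < _)%E](ge0_integral_pushforward (measurable_rshift a) mu
    (f := fun x => (normc (f x) ^+ 2)%:E) (D := setT))//=.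
  + rewrite (eq_measure_integral mu)//; first exact: measurable_rshift.
    by move=> mf A mA _; exact: lebesgue_measure_rshift.
  + by apply/measurable_EFinP; exact: measurable_normc_sqr.
  + by move=> y _; rewrite lee_fin sqr_ge0.
Qed.

(* T_a f is the class of x |-> f (x - a); transl_class shows that the choice of
   representative is irrelevant, and likewise modul_class below. *)
Definition transl (a : R) (f : L2) : L2 :=
  L2class (L2Fun (sqint_transl a (L2rep f))).

Lemma transl_class a f : transl a (L2class f) =
  L2class (L2Fun (sqint_transl a f)).
Proof. by apply/L2classE => /=; exact: (ae_rshift a (L2rep_class f)). Qed.

Lemma transl_add a b f : transl a (transl b f) = transl (a + b) f.
Proof.
rewrite -[f]L2repK !transl_class; congr L2class; apply/val_inj/funext => x /=.
by congr (l2fun _ _); ring.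
Qed.

Lemma transl0 f : transl 0 f = f.
Proof.
rewrite -[f]L2repK !transl_class; congr L2class; apply/val_inj/funext => x /=.
by rewrite subr0.
Qed.

Definition expi (t : R) : R[i] := cos t +i* sin t.

Lemma expiD s t : expi (s + t) = expi s * expi t.
Proof. by rewrite /expi cosD sinD -[RHS]/(_ +i* _); congr (_ +i* _); ring. Qed.

Lemma normc_expi t : normc (expi t) = 1.
Proof. by rewrite /= cos2Dsin2 sqrtr1. Qed.

Lemma sqint_modul b (f : L2fun) :
  (fun x => expi (2 * pi * b * x) * f x) \in sqint.
Proof.
have /asboolP[mr mi fi] := l2funP f.
have mc : measurable_fun setT (fun x : R => cos (2 * pi * b * x)).
  apply: (measurableT_comp (f := cos)) => //.
  by apply: continuous_measurable_fun; exact: continuous_cos.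
have ms : measurable_fun setT (fun x : R => sin (2 * pi * b * x)).
  apply: (measurableT_comp (f := sin)) => //.
  by apply: continuous_measurable_fun; exact: continuous_sin.
apply/asboolP; split.
- have -> : Re \o (fun x => expi (2 * pi * b * x) * f x) =
    fun x => cos (2 * pi * b * x) * Re (f x) - sin (2 * pi * b * x) * Im (f x).
    by apply/funext => x /=; case: (f x).
  by apply: measurable_funB; exact: measurable_funM.
- have -> : Im \o (fun x => expi (2 * pi * b * x) * f x) =
    fun x => cos (2 * pi * b * x) * Im (f x) + sin (2 * pi * b * x) * Re (f x).
    by apply/funext => x /=; case: (f x).
  by apply: measurable_funD; exact: measurable_funM.
- by under eq_integral => x _ do rewrite Normc.normcM normc_expi mul1r.
Qed.

(* E_b f is the class of x |-> e^(2 pi i b x) f x. *)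
Definition modul (b : R) (f : L2) : L2 :=
  L2class (L2Fun (sqint_modul b (L2rep f))).

Lemma modul_class b f : modul b (L2class f) =
  L2class (L2Fun (sqint_modul b f)).
Proof.
by apply/L2classE => /=; apply: lebesgue_aeS (L2rep_class f) => x ->.
Qed.

Lemma modul_add a b f : modul a (modul b f) = modul (a + b) f.
Proof.
rewrite -[f]L2repK !modul_class; congr L2class; apply/val_inj/funext => x /=.
by rewrite mulrA -expiD; congr (expi _ * _); ring.
Qed.

Lemma modul0 f : modul 0 f = f.
Proof.
rewrite -[f]L2repK !modul_class; congr L2class; apply/val_inj/funext => x /=.
by rewrite mulr0 mul0r /expi cos0 sin0 -[1 +i* 0]/(1 : R[i]) mul1r.
Qed.

Definition gabor (g : L2) (a b : R) (mn : int * int) : L2 :=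
  opz (modul b) mn.1 (opz (transl a) mn.2 g).

Lemma opz_additive (W : R -> L2 -> L2) :
  (forall a b f, W a (W b f) = W (a + b) f) -> (forall f, W 0 f = f) ->
  forall a k f, opz (W a) k f = W (k%:~R * a) f.
Proof.
move=> WD W0 a k f.
have WK c : cancel (W c) (W (- c)) by move=> h; rewrite WD addNr W0.
have WKN c : cancel (W (- c)) (W c) by move=> h; rewrite WD subrr W0.
have It c n h : iter n (W c) h = W (n%:R * c) h.
  elim: n => [|n IH]; first by rewrite mul0r W0.
  by rewrite iterS IH WD -{1}[c]mul1r -mulrDl -natr1 addrC.
rewrite (opz_can (WK a) (WKN a)); case: k => n; rewrite It//.
by rewrite NegzE mulrN rmorphN mulNr.
Qed.

Lemma gaborE g a b m n :
  gabor g a b (m, n) = modul (m%:~R * b) (transl (n%:~R * a) g).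
Proof.
rewrite /gabor/= (opz_additive modul_add modul0).
by rewrite (opz_additive transl_add transl0).
Qed.

End L2.

Arguments L2dot {R} f g.

(* Main.v *)
Require Import Defs.
From mathcomp Require Import all_boot all_order all_algebra complex.
From mathcomp Require Import all_classical all_reals all_analysis.
From mathcomp Require Import measurable_realfun sesquilinear finmap ring lra.

(** The supports of distinct translates T_a^n g meet in null sets, so f_k
    and f_l are orthogonal as soon as the translation indices beta k and beta l
    of the pairs sigma k and sigma l differ. This is incompatible with
    f_k = T^k f_0, unless the family is a Riesz basis, as follows.

    Let c be a square summable sequence with sum_k c_k f_k = 0. Two operations
    preserve such relations.
    - Shifts: sum_k c_k f_(k+j) = 0 for every integer j (null_shift). Shifting
      up means applying T. Shifting down cannot rely on a bound for the inverse
      of T, which is only known to be a bijection; instead, by the Bessel bound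
      and the completeness of L^2, sum_k c_k f_(k+j-1) converges (synthesis_ex),
      its image by T is 0, and T is injective.
    - Restriction to a block: by Pythagoras, in a vanishing sum of vectors the
      sub-sum over the indices with a given value of beta vanishes too
      (has_sum0_orthogonal).
    Combining them, the sum may be restricted to the k with
    beta (k + j) = m, for arbitrary j and m. Since beta takes infinitely many
    values it has no nonzero period, so for p <> l some j yields
    beta (p + j) <> beta (l + j) (surj_separated). Restricting repeatedly, the
    relation can be confined to a set of indices which contains p and avoids any
    given finite set of other indices (null_avoid). What remains besides
    c_p f_p is then a tail of a convergent sum, hence as small as desired:
    c_p f_p = 0, and c_p = 0 (orbit_riesz).

    Completeness of L^2 is proved in the form of L2_fast_complete: a series
    whose norms decrease geometrically is dominated pointwise, almost
    everywhere, by a geometric series times a square integrable function. *)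

Set Implicit Arguments.
Unset Strict Implicit.
Unset Printing Implicit Defensive.

Import Order.TTheory GRing.Theory Num.Theory.
Import numFieldNormedType.Exports.

Local Open Scope complex_scope.
Local Open Scope classical_set_scope.
Local Open Scope ring_scope.

(** * Unconditional sums in a space with an inner product *)

Lemma sum_fsetD (J : choiceType) (V : nmodType) (u : J -> V) (F K : {fset J}) :
  (F `<=` K)%fset ->
  \sum_(j <- K) u j = \sum_(j <- F) u j + \sum_(j <- (K `\` F)%fset) u j.
Proof.
move=> FK; rewrite (big_fsetID _ (mem F) K)/=; congr (_ + _).
  apply: eq_fbigl => j; rewrite !inE/= andbC.
  by case: (boolP (j \in F)) => //= /(fsubsetP FK) ->.
by apply: eq_fbigl => j; rewrite !inE/= andbC.
Qed.

Section pre_hilbert.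
Context {R : realType} {H : lmodType R[i]} (dot : {dot H for @conjc R}).

Definition sqnorm (u : H) : R := complex.Re (dot u u).

Lemma Re_dotC u v : complex.Re (dot u v) = complex.Re (dot v u).
Proof.
have Re_conj (z : R[i]) : complex.Re (conjc z) = complex.Re z by case: z.
by rewrite (hermC dot) expr0 mul1r /=; exact: Re_conj.
Qed.

Lemma sqnorm_ge0 u : 0 <= sqnorm u.
Proof. by have := dnorm_ge0 dot u; rewrite lecE => /andP[]. Qed.

Lemma sqnorm_eq0 u : sqnorm u = 0 -> u = 0.
Proof.
move=> u0; apply/eqP; rewrite -(dnorm_eq0 dot) eq_complex -/(sqnorm u) u0.
rewrite eqxx /=.
by have := dnorm_ge0 dot u; rewrite lecE => /andP[].
Qed.

Lemma sqnormD u v :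
  sqnorm (u + v) = sqnorm u + sqnorm v + 2 * complex.Re (dot u v).
Proof.
rewrite /sqnorm linearDl !linearDr /= !raddfD /= (Re_dotC v u); ring.
Qed.

Lemma sqnormN u : sqnorm (- u) = sqnorm u.
Proof. by rewrite /sqnorm hnormN. Qed.

Lemma sqnormD_le u v : sqnorm (u + v) <= 2 * sqnorm u + 2 * sqnorm v.
Proof.
have := sqnorm_ge0 (u - v); rewrite !sqnormD sqnormN linearNr raddfN /=; lra.
Qed.

Lemma sqr_hnorm u : hnorm dot u ^+ 2 = sqnorm u.
Proof. by rewrite sqr_sqrtr// sqnorm_ge0. Qed.

Lemma hnorm_lt u e : 0 < e -> (hnorm dot u < e) = (sqnorm u < e ^+ 2).
Proof.
by move=> e0; rewrite -sqr_hnorm ltr_sqr ?nnegrE ?sqrtr_ge0// ltW.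
Qed.

Lemma has_sumP (J : choiceType) (u : J -> H) s : has_sum dot u s <->
  forall e : R, 0 < e -> exists F0 : {fset J}, forall F : {fset J},
    (F0 `<=` F)%fset -> sqnorm (\sum_(j <- F) u j - s) < e.
Proof.
split=> us e e0.
  have /us[F0 uF0] : 0 < Num.sqrt e by rewrite sqrtr_gt0.
  by exists F0 => F /uF0; rewrite hnorm_lt ?sqrtr_gt0// sqr_sqrtr// ltW.
have /us[F0 uF0] : 0 < e ^+ 2 by rewrite exprn_gt0.
by exists F0 => F /uF0; rewrite hnorm_lt.
Qed.

Lemma bounded_sqnorm (T : H -> H) : bounded_operator dot T ->
  exists2 M : R, 0 < M & forall h, sqnorm (T h) <= M * sqnorm h.
Proof.
move=> [M TM]; exists (M ^+ 2 + 1); first by rewrite ltr_wpDl// sqr_ge0.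
move=> h; rewrite -!sqr_hnorm mulrDl mul1r.
apply: (@le_trans _ _ (M ^+ 2 * hnorm dot h ^+ 2)); last first.
  by rewrite lerDl sqr_ge0.
rewrite -exprMn; have := TM h; have : 0 <= hnorm dot (T h) by exact: sqrtr_ge0.
move: (hnorm _ (T h)) (M * _) => x y x0 xy.
by rewrite ler_sqr// nnegrE; exact: le_trans xy.
Qed.

Lemma has_sum_map (J : choiceType) (u : J -> H) s (T : {linear H -> H}) :
  bounded_operator dot T -> has_sum dot u s -> has_sum dot (T \o u) (T s).
Proof.
move=> /bounded_sqnorm[M M0 TM] /has_sumP us; apply/has_sumP => e e0.
have /us[F0 uF0] : 0 < e / M by rewrite divr_gt0.
exists F0 => F /uF0; rewrite ltr_pdivlMr// mulrC; apply: le_lt_trans.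
have -> : \sum_(j <- F) (T \o u) j - T s = T (\sum_(j <- F) u j - s).
  by rewrite raddfB raddf_sum.
exact: TM.
Qed.

Lemma has_sum_unique (J : choiceType) (u : J -> H) s t :
  has_sum dot u s -> has_sum dot u t -> s = t.
Proof.
move=> /has_sumP us /has_sumP ut; apply/eqP; rewrite -subr_eq0; apply/eqP.
apply: sqnorm_eq0; apply/eqP; rewrite eq_le sqnorm_ge0 andbT leNgt.
apply/negP => st0; have e0 : 0 < sqnorm (s - t) / 4 by rewrite divr_gt0.
have [F uF] := us _ e0; have [G uG] := ut _ e0.
have := uF _ (fsubsetUl F G); have := uG _ (fsubsetUr F G).
set S := \sum_(j <- _) _ => St Ss.
have := sqnormD_le (S - t) (- (S - s)); rewrite sqnormN.
have -> : S - t - (S - s) = s - t by rewrite opprB addrC addrA subrK.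
lra.
Qed.

Lemma has_sum_cauchy (J : choiceType) (u : J -> H) s : has_sum dot u s ->
  forall e : R, 0 < e -> exists F0 : {fset J}, forall F : {fset J},
    [disjoint F0 & F]%fset -> sqnorm (\sum_(j <- F) u j) < e.
Proof.
move=> /has_sumP us e e0; have /us[F0 uF0] : 0 < e / 4 by rewrite divr_gt0.
exists F0 => F dF.
have := uF0 _ (fsubset_refl _); have := uF0 _ (fsubsetUl F0 F).
rewrite (sum_fsetD _ (fsubsetUl F0 F)) fsetDUl fsetDv fset0U.
rewrite (fsetDidPl _ _ _); last by rewrite fdisjoint_sym.
set S := \sum_(j <- F0) _; set S' := \sum_(j <- F) _.
move=> h1 h2; have := sqnormD_le (S + S' - s) (- (S - s)); rewrite sqnormN.
have -> : S + S' - s - (S - s) = S'.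
  by rewrite opprB addrA subrK addrAC subrr add0r.
lra.
Qed.

(** Completeness, tested on the series whose squared norms are below 16^-n:
    every Cauchy condition reduces to such a series by extracting partial sums,
    and the rate 16 leaves room for the pointwise weight 4^n in the case of
    L^2. *)
Definition fast_complete : Prop :=
  forall u : nat -> H, (forall n, sqnorm (u n) <= 16^-1 ^+ n) ->
  exists s, forall e : R, 0 < e -> exists N, forall n, (N <= n)%N ->
    sqnorm (\sum_(i < n) u i - s) < e.

(** The partial sums over an increasing sequence of finite sets F n, chosen by
    the Cauchy condition, telescope into a rapidly decreasing series. *)
Lemma cauchy_has_sum (J : choiceType) (u : J -> H) : fast_complete ->
  (forall e : R, 0 < e -> exists F0 : {fset J}, forall F : {fset J},
    [disjoint F0 & F]%fset -> sqnorm (\sum_(j <- F) u j) < e) ->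
  exists s, has_sum dot u s.
Proof.
move=> cpl cu.
have q0 n : 0 < 16^-1 ^+ n :> R by rewrite exprn_gt0// invr_gt0.
have [G uG] := choice (fun n => cu _ (q0 n)).
pose F := fix F n := if n is n'.+1 then (F n' `|` G n)%fset else G 0%N.
have GF n : (G n `<=` F n)%fset by case: n => [|n] //=; exact: fsubsetUr.
have FS n : (F n `<=` F n.+1)%fset by exact: fsubsetUl.
pose S n := \sum_(j <- F n) u j.
have dS n (K : {fset J}) : (F n `<=` K)%fset ->
    sqnorm (\sum_(j <- K) u j - S n) < 16^-1 ^+ n.
  move=> FK; rewrite (sum_fsetD _ FK) addrC addKr.
  apply: uG; apply/fdisjointP => j /(fsubsetP (GF n)) jF.
  by rewrite !inE jF.
have [|s us] := cpl (fun n => S n.+1 - S n).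
  by move=> n; exact/ltW/dS.
have tel n : \sum_(i < n) (S i.+1 - S i) = S n - S 0%N.
  by rewrite -(big_mkord xpredT (fun i => S i.+1 - S i)) telescope_sumr.
(* The telescoping series omits the initial partial sum S 0. *)
exists (s + S 0%N); apply/has_sumP => e e0.
have e4 : 0 < e / 4 by rewrite divr_gt0.
have [N uN] := us _ e4.
have [n nN nq] : exists2 n, (N <= n)%N & 16^-1 ^+ n < e / 4 :> R.
  have : (fun n => (16^-1 : R) ^+ n) @ \oo --> (0 : R).
    by apply: cvg_expr; rewrite ger0_norm ?invr_ge0// invf_lt1// ltr1n.
  move=> /cvgrPdist_lt /(_ _ e4)[m _ mq].
  exists (maxn m N); first exact: leq_maxr.
  have := mq (maxn m N) (leq_maxl _ _).
  by rewrite /= sub0r normrN ger0_norm// ltW.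
exists (F n) => K /dS Kn; have := uN _ nN; rewrite tel => Sn.
have := sqnormD_le (\sum_(j <- K) u j - S n) (S n - S 0%N - s).
have -> : \sum_(j <- K) u j - S n + (S n - S 0%N - s) =
  \sum_(j <- K) u j - (s + S 0%N).
  by rewrite -[S n - S 0%N - s]addrA subrKA opprD [- s + _]addrC.
lra.
Qed.

End pre_hilbert.

(** * Bessel families *)

Lemma fsum_le_esum (R : realType) (J : choiceType) (a : J -> R)
    (F : {fset J}) :
  ((\sum_(j <- F) a j)%:E <= \esum_(j in [set: J]) (a j)%:E)%E.
Proof.
apply: ereal_sup_ubound; exists [set` F] => //=.
by rewrite fsbig_finite// set_fsetK sumEFin.
Qed.

(** A finite set whose partial sum is within e of the supremum leaves less than
    e to the finite sets disjoint from it. *)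
Lemma ell2_tail (R : realType) (J : choiceType) (c : J -> R[i]) : in_ell2 c ->
  forall e : R, 0 < e -> exists F0 : {fset J}, forall F : {fset J},
    [disjoint F0 & F]%fset -> \sum_(j <- F) Normc.normc (c j) ^+ 2 < e.
Proof.
rewrite /in_ell2 => c2 e e0; set a := fun j => Normc.normc (c j) ^+ 2.
have Efin : (\esum_(j in [set: J]) (a j)%:E)%E \is a fin_num.
  rewrite ge0_fin_numE//; apply: esum_ge0 => j _.
  by rewrite lee_fin; exact: sqr_ge0.
have [_ [X [finX _] <-]] := ub_ereal_sup_adherent e0 Efin.
rewrite fsbig_finite// sumEFin => EX; exists (fset_set X) => F dF.
have := fsum_le_esum a (fset_set X `|` F)%fset.
rewrite (sum_fsetD _ (fsubsetUl _ F)) fsetDUl fsetDv fset0U.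
rewrite (fsetDidPl _ _ _); last by rewrite fdisjoint_sym.
move: EX; rewrite -[ereal_sup _]/(esum _ _) -(fineK Efin) -EFinB.
by rewrite lte_fin lee_fin; lra.
Qed.

Section synthesis.
Context {R : realType} {H : lmodType R[i]} (dot : {dot H for @conjc R}).
Local Notation sqnorm := (sqnorm dot).
Local Notation normc := Normc.normc.

Definition bessel (J : choiceType) (f : J -> H) (B : R) : Prop :=
  forall h (F : {fset J}),
    \sum_(j <- F) normc (dot h (f j)) ^+ 2 <= B * sqnorm h.

Lemma normc_dotC u v : normc (dot u v) = normc (dot v u).
Proof.
have normc_conj (z : R[i]) : normc (conjc z) = normc z.
  by case: z => x y /=; rewrite sqrrN.
by rewrite (hermC dot) expr0 mul1r /=; exact: normc_conj.
Qed.

(** Expanding one factor h of (h, h) writes the squared norm of h as the sum of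
    the Re (c_j (f_j, h)). The inequality 2xy <= B x^2 + y^2 / B applies to each
    term, and the Bessel bound makes the second half of the result at most half
    of the squared norm, which is absorbed in the left-hand side. *)
Lemma bessel_synthesis (J : choiceType) (f : J -> H) (B : R) : 0 < B ->
  bessel f B -> forall (c : J -> R[i]) (F : {fset J}),
  sqnorm (\sum_(j <- F) c j *: f j) <= B * \sum_(j <- F) normc (c j) ^+ 2.
Proof.
move=> B0 fB c F; set h := \sum_(j <- F) _.
have amgm (y z : R[i]) :
    complex.Re (y * z) <= B / 2 * normc y ^+ 2 + (2 * B)^-1 * normc z ^+ 2.
  rewrite !normc_sqr; case: y z => p q [r s] /=.
  rewrite -(ler_pM2l (_ : 0 < 2 * B)) ?mulr_gt0//.
  rewrite [leRHS](_ : _ = B ^+ 2 * (p ^+ 2 + q ^+ 2) + (r ^+ 2 + s ^+ 2)).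
    have := sqr_ge0 (B * p - r); have := sqr_ge0 (B * q + s); nra.
  by move: B0 => /lt0r_neq0 B0; field.
have : sqnorm h <= B / 2 * \sum_(j <- F) normc (c j) ^+ 2
    + (2 * B)^-1 * \sum_(j <- F) normc (dot h (f j)) ^+ 2.
  rewrite -[sqnorm h]/(complex.Re (dot h h)) {1}/h linear_sumlz raddf_sum/=.
  rewrite !mulr_sumr -big_split/=.
  apply: ler_sum => j _; rewrite linearZl_LR normc_dotC; exact: amgm.
have := fB h F; rewrite -(ler_pM2l (_ : 0 < (2 * B)^-1)) ?invr_gt0 ?mulr_gt0//.
rewrite [(2 * B)^-1 * (B * _)](_ : _ = sqnorm h / 2); first lra.
by field; rewrite gt_eqF.
Qed.

Lemma synthesis_ex (J : choiceType) (f : J -> H) (B : R) (c : J -> R[i]) :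
  fast_complete dot -> 0 < B -> bessel f B -> in_ell2 c ->
  exists s, has_sum dot (fun j => c j *: f j) s.
Proof.
move=> cpl B0 fB c2; apply: cauchy_has_sum => // e e0.
have [|F0 cF0] := ell2_tail c2 (_ : 0 < e / B); first by rewrite divr_gt0.
exists F0 => F /cF0; rewrite ltr_pdivlMr// mulrC; apply: le_lt_trans.
exact: bessel_synthesis.
Qed.

Lemma bessel_inj (I J : choiceType) (f : J -> H) (B : R) (s : I -> J) :
  injective s -> bessel f B -> bessel (f \o s) B.
Proof.
move=> sI fB h F; have := fB h (s @` F)%fset.
by rewrite big_imfset//= => i j _ _; exact: sI.
Qed.

Lemma frame_bessel (J : countType) (f : J -> H) : frame dot f ->
  exists2 B, 0 < B & bessel f B.
Proof.
move=> [A [B [_ B0 fAB]]]; exists B => // h F; have /andP[_] := fAB h.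
by rewrite sqr_hnorm -lee_fin; apply: le_trans; exact: fsum_le_esum.
Qed.

End synthesis.

(** * Linear relations in the orbit of an operator *)

(** A nonzero period d would make beta constant on the classes modulo d, so
    that it would take at most |d| values. *)
Lemma surj_separated (beta : int -> int) : (forall m, exists k, beta k = m) ->
  forall p l, p != l -> exists j, beta (p + j) != beta (l + j).
Proof.
move=> bsurj p l pl; apply: contrapT => /forallNP bpl.
pose d := l - p; have d0 : d != 0 by rewrite subr_eq0 eq_sym.
have per i : beta (i + d) = beta i.
  have /negP := bpl (i - p); rewrite negbK => /eqP; rewrite addrC subrK => ->.
  by congr beta; rewrite /d addrCA.
have perN i : beta (i - d) = beta i by rewrite -[in RHS](subrK d i) per.
have perM i (n : int) : beta (i + n * d) = beta i.
  elim: n => [|n IH|n IH]; first by rewrite mul0r addr0.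
    by rewrite -addn1 PoszD mulrDl mul1r addrA per.
  by rewrite -addn1 PoszD opprD mulrDl mulN1r addrA perN.
have modE i : beta (i %% d)%Z = beta i.
  by rewrite [in RHS](divz_eq i d) addrC perM.
have [x bx] := choice bsurj.
have r_lt (n : 'I_`|d|.+1) : (`|(x n%:Z %% d)%Z| < `|d|)%N.
  by rewrite -ltz_nat gez0_abs ?modz_ge0// ltz_mod.
pose r n := Ordinal (r_lt n).
(* One residue modulo d for each of |d| + 1 values of beta. *)
have r_inj : injective r.
  move=> m n /(congr1 val)/= /(congr1 Posz); rewrite !gez0_abs ?modz_ge0//.
  move=> /(congr1 beta); rewrite !modE !bx => -[] mn; exact: val_inj.
by have := leq_card r r_inj; rewrite !card_ord ltnn.
Qed.

Section orbit.
Context {R : realType} {H : lmodType R[i]} (dot : {dot H for @conjc R}).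
Local Notation sqnorm := (sqnorm dot).

(** For every finite set, the sum over one block is orthogonal to the rest of
    the sum, hence at most as large as the whole. *)
Lemma has_sum0_orthogonal (J : choiceType) (I : eqType) (beta : J -> I)
    (u : J -> H) (m : I) :
  (forall i j, beta i != beta j -> dot (u i) (u j) = 0) ->
  has_sum dot u 0 ->
  has_sum dot (fun j => if beta j == m then u j else 0) 0.
Proof.
move=> uo /has_sumP us; apply/has_sumP => e /us[F0 uF0].
exists F0 => F /uF0; apply: le_lt_trans; rewrite !subr0.
set v := \sum_(j <- F) _.
pose w := \sum_(j <- F) if beta j == m then 0 else u j.
have -> : \sum_(j <- F) u j = v + w.
  rewrite -big_split/=; apply: eq_bigr => j _.
  by case: ifP; rewrite ?addr0 ?add0r.
rewrite sqnormD (_ : dot v w = 0).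
  by rewrite mulr0 addr0 lerDl sqnorm_ge0.
rewrite /v linear_sumlz big1// => i _; rewrite /w linear_sumr big1// => j _.
case: ifP => [/eqP im|_]; last by rewrite linear0l.
by case: ifPn => [_|jm]; [rewrite linear0r|apply: uo; rewrite im eq_sym].
Qed.

Context (f : int -> H) (T : {linear H -> H}) (B : R).
Hypotheses (cpl : fast_complete dot) (B0 : 0 < B) (fB : bessel dot f B).
Hypotheses (Tbd : bounded_operator dot T) (Tinj : injective T).
Hypothesis Tf : forall k, T (f k) = f (k + 1).

Let null (c : int -> R[i]) j := has_sum dot (fun k => c k *: f (k + j)) 0.

(** Descending, the shifted series has a sum s because of square summability,
    and T s = 0. *)
Let nullS c j : in_ell2 c -> null c j <-> null c (j + 1).
Proof.
move=> c2; have TE : T \o (fun k => c k *: f (k + j)) =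
    (fun k => c k *: f (k + (j + 1))).
  by apply/funext => k /=; rewrite linearZ_LR/= Tf addrA.
split=> [|cj]; first by move=> /(has_sum_map Tbd); rewrite TE linear0.
have fBj : bessel dot (f \o (fun k => k + j)) B.
  by apply: bessel_inj fB; exact: addIr.
have [s cs] := synthesis_ex cpl B0 fBj c2.
have : has_sum dot (fun k => c k *: f (k + (j + 1))) (T s).
  by rewrite -TE; exact: has_sum_map.
move=> /(has_sum_unique cj)/esym; rewrite -(linear0 T) => /Tinj s0.
by move: cs; rewrite s0.
Qed.

Lemma null_shift c i j : in_ell2 c -> null c i -> null c j.
Proof.
move=> c2; have nullD k (n : nat) : null c k <-> null c (k + n).
  elim: n => [|n IH]; first by rewrite addr0.
  by rewrite IH (nullS _ c2) -addrA -PoszD addn1.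
case: (leP i j) => [ij|/ltW ji].
  have -> : j = i + `|j - i|%N by rewrite gez0_abs ?subr_ge0// subrKC.
  by move/(nullD i _).1.
have -> : i = j + `|i - j|%N by rewrite gez0_abs ?subr_ge0// subrKC.
by move/(nullD j _).2.
Qed.

Context (beta : int -> int).
Hypotheses (bsurj : forall m, exists k, beta k = m).
Hypotheses (fo : forall k l, beta k != beta l -> dot (f k) (f l) = 0).

Let restr (A : pred int) (c : int -> R[i]) k := if A k then c k else 0.

Let restr_ell2 A c : in_ell2 c -> in_ell2 (restr A c).
Proof.
apply: le_lt_trans; apply: le_esum => k _; rewrite lee_fin /restr.
by case: ifP => // _; rewrite Normc.normc0 expr0n/= sqr_ge0.
Qed.

(** To exclude one more index l, shift the relation by a j that separates p and
    l, keep only the block of p + j, and shift back. *)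
Lemma null_avoid c p (s : seq int) : in_ell2 c -> null c 0 -> p \notin s ->
  exists A : pred int,
    [/\ A p, forall l, l \in s -> ~~ A l & null (restr A c) 0].
Proof.
move=> c2 c0; elim: s => [_|l s IH].
  by exists xpredT; split => //; rewrite /restr /=.
rewrite inE negb_or => /andP[pl /IH[A [Ap As nA]]].
have [j bj] := surj_separated bsurj pl.
exists (fun k => A k && (beta (k + j) == beta (p + j))); split.
- by rewrite Ap eqxx.
- move=> k; rewrite inE => /predU1P[->|/As/negbTE->//].
  by rewrite [beta (l + j) == _]eq_sym (negbTE bj) andbF.
apply: (@null_shift _ j); first exact: restr_ell2.
have nj : null (restr A c) j by apply: null_shift nA; exact: restr_ell2.
have uo k l' : beta (k + j) != beta (l' + j) ->
    dot (restr A c k *: f (k + j)) (restr A c l' *: f (l' + j)) = 0.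
  by move=> /fo kl; rewrite linearZl_LR linearZr_LR/= kl !mulr0.
have := has_sum0_orthogonal (beta (p + j)) uo nj.
rewrite /null; congr (has_sum _ _ _); apply/funext => k; rewrite /restr.
by case: (A k) => /=; case: eqP; rewrite ?scale0r.
Qed.

(** Confining the relation to a set which contains p and misses the rest of F0
    leaves c_p f_p plus finitely many terms outside F0, whose sum is small by
    the choice of F0. *)
Lemma orbit_riesz c p : in_ell2 c -> has_sum dot (fun k => c k *: f k) 0 ->
  f p != 0 -> c p = 0.
Proof.
move=> c2 cf fp0; have c0 : null c 0.
  by move: cf; congr (has_sum _ _ _); apply/funext => k; rewrite addr0.
suff /eqP : c p *: f p = 0.
  by rewrite scaler_eq0 (negbTE fp0) orbF => /eqP.
apply: (@sqnorm_eq0 _ _ dot); apply/eqP; rewrite eq_le sqnorm_ge0 andbT leNgt.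
apply/negP => /[dup]; set e := sqnorm _ => e0; apply/negP; rewrite -leNgt.
have e4 : 0 < e / 4 by rewrite divr_gt0.
have [F0 cF0] := has_sum_cauchy c0 e4.
have pF : p \notin (F0 `\ p)%fset by rewrite !inE eqxx.
have [A [Ap AF nA]] := null_avoid c2 c0 pF.
have /has_sumP /(_ _ e4) [F1 cF1] := nA.
have := cF1 _ (fsubsetUr [fset p]%fset F1); set K := (p |` F1)%fset.
rewrite subr0 (big_fsetD1 p) ?fset1U1//=.
have -> : restr A c p *: f (p + 0) = c p *: f p by rewrite /restr Ap addr0.
set w := \sum_(k <- _) _ => h1.
have h2 : sqnorm w < e / 4.
  rewrite (_ : w =
      \sum_(k <- [fset k in (K `\ p) | A k]%fset) c k *: f (k + 0)).
    apply: cF0; apply/fdisjointP => k kF0; rewrite !inE/=.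
    case: (eqVneq k p) => //= kp; rewrite negb_and; apply/orP; right.
    by apply: AF; rewrite !inE kp.
  rewrite /w big_fset/= [RHS]big_mkcond/=; apply: eq_bigr => k _.
  by rewrite /restr; case: ifP => //; rewrite scale0r.
have := sqnormD_le dot (c p *: f p + w) (- w); rewrite sqnormN addrK -/e; lra.
Qed.

End orbit.

(** * Completeness of the space of square integrable functions *)

Section geometric.
Context {R : realType}.

(** The factor 2 is the sum of the geometric series of ratio 1/2. *)
Lemma geometric_dominated_series (a : nat -> R) (K : R) :
  (forall n, `|a n| <= K * 2^-1 ^+ n) ->
  cvgn (series a) /\
  forall n, `|series a n - limn (series a)| <= 2 * K * 2^-1 ^+ n.
Proof.
move=> aK.
have tail n m : `|series a (n + m)%N - series a n| <=
    2 * K * 2^-1 ^+ n - 2 * K * 2^-1 ^+ (n + m).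
  elim: m => [|m IH]; first by rewrite addn0 !subrr normr0.
  rewrite addnS seriesSr addrAC; apply: (le_trans (ler_normD _ _)).
  by have := aK (n + m)%N; rewrite exprS; lra.
have K0 : 0 <= K by have := aK 0%N; rewrite expr0 mulr1; exact: le_trans.
have cvg_a : cvgn (series a).
  apply: normed_cvg; apply: (@series_le_cvg _ _ (geometric K 2^-1)).
  - by move=> n; exact: normr_ge0.
  - by move=> n; rewrite /= mulr_ge0// exprn_ge0.
  - by move=> n; exact: aK.
  - by apply: is_cvg_geometric_series; rewrite ger0_norm// invf_lt1// ltr1n.
split=> // n; apply/ler_addgt0Pr => e e0.
have /cvgrPdist_lt /(_ _ e0) [m _ am] := cvg_a.
have := am (n + m)%N (leq_addl _ _) => /= lm.
have := ler_distD (series a (n + m)%N) (series a n) (limn (series a)).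
rewrite distrC in lm; rewrite (distrC (series a n) (series a (n + m)%N)).
have := tail n m; have : 0 <= 2 * K * 2^-1 ^+ (n + m).
  by rewrite !mulr_ge0// exprn_ge0.
lra.
Qed.

End geometric.

Section L2_complete.
Context {R : realType}.
Local Notation mu := (@lebesgue_measure R).
Local Notation normc := Normc.normc.

Lemma sqnorm_L2class (f : L2fun R) :
  ((sqnorm L2dot (L2class f))%:E = \int[mu]_x (normc (f x) ^+ 2)%:E)%E.
Proof.
have If := sqint_integrable (l2funP f).
rewrite -[RHS]fineK; last exact: (integrable_fin_num measurableT If).
congr EFin; rewrite -[LHS]/(complex.Re (L2dot _ _)) L2dot_class /Cintegral/=.
apply: eq_Rintegral => x _; rewrite normc_sqr.
by case: (f x) => p q /=; rewrite mulrN opprK.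
Qed.

Lemma sum_L2fun (I : Type) (r : seq I) (f : I -> L2fun R) x :
  (\sum_(i <- r) f i) x = \sum_(i <- r) f i x.
Proof. by elim/big_rec2: _ => // i y g _ <-. Qed.

(** The function G x = sum_n 4^n |u_n(x)|^2 has a finite integral, by monotone
    convergence and the bound 4^n |u_n|^2 <= 4^-n on the norms. Where G is
    finite, |u_n(x)| <= sqrt(G x) 2^-n, so the series converges to a value D x
    and the squared error after n terms is at most a multiple of 4^-n G x.
    Integrating this bound shows both that D is square integrable and that the
    series converges to D in norm. *)
Lemma L2_fast_complete : fast_complete (@L2dot R).
Proof.
move=> u u16; pose d n := L2rep (u n).
have normc2 n : measurable_fun setT (fun x => normc (d n x) ^+ 2).
  by have /asboolP[mr mi _] := l2funP (d n); exact: measurable_normc_sqr.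
pose w n (x : R) : \bar R := (4 ^+ n * normc (d n x) ^+ 2)%:E.
have w0 n x : (0 <= w n x)%E by rewrite lee_fin mulr_ge0 ?sqr_ge0 ?exprn_ge0.
have mw n : measurable_fun setT (w n).
  by apply/measurable_EFinP; exact: measurable_funM.
pose G (x : R) : \bar R := (\sum_(n <oo) w n x)%E.
have G0 x : (0 <= G x)%E by exact: nneseries_ge0.
have mG : measurable_fun setT G by exact: ge0_emeasurable_sum.
have GI : (\int[mu]_x G x < +oo)%E.
  rewrite integral_nneseries//.
  apply: (@le_lt_trans _ _ (2%:E)); last exact: ltry.
  apply: le_trans (epsilon_trick0 xpredT (_ : 0 <= 2 :> R)) => //.
  apply: lee_nneseries => n _; first by move=> _; exact: integral_ge0.
  rewrite /w; under eq_integral do rewrite EFinM.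
  rewrite ge0_integralZl_EFin ?exprn_ge0//; last 2 first.
  - by move=> x _; rewrite lee_fin sqr_ge0.
  - by apply/measurable_EFinP; exact: normc2.
  rewrite -sqnorm_L2class L2repK -EFinM lee_fin.
  apply: (@le_trans _ _ (4 ^+ n * 16^-1 ^+ n)).
    by rewrite ler_pM2l ?exprn_gt0.
  rewrite -exprMn natrX exprS invfM mulVKf// -exprVn.
  by rewrite lerXn2r ?nnegrE//; lra.
have iG : mu.-integrable setT G.
  apply/integrableP; split => //.
  by under eq_integral do rewrite gee0_abs//.
pose Z := [set x | G x \is a fin_num].
have mZ : measurable Z.
  by rewrite -[Z]setTI; exact: emeasurable_fin_num.
have aeZ : \forall x \ae mu, Z x.
  by apply: lebesgue_aeS (integrable_ae measurableT iG) => x; exact.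
pose gx (x : R) : R := fine (G x).
have gx0 x : 0 <= gx x by exact: fine_ge0.
have mgx : measurable_fun setT gx.
  by apply: measurableT_comp mG; exact: fine_measurable.
have igx : mu.-integrable setT (EFin \o gx).
  apply: le_integrable iG => //; first by apply/measurable_EFinP; exact: mgx.
  move=> x _; rewrite !gee0_abs ?lee_fin//= /gx.
  by case: (G x) (G0 x) => // r; rewrite leNye.
have d_le n x : Z x -> normc (d n x) <= Num.sqrt (gx x) * 2^-1 ^+ n.
  move=> Zx.
  rewrite -ler_sqr ?nnegrE ?mulr_ge0 ?sqrtr_ge0 ?exprn_ge0//; last first.
    by case: (d n x) => ? ?; exact: sqrtr_ge0.
  rewrite exprMn sqr_sqrtr// -exprM mulnC exprM.
  rewrite (_ : 2^-1 ^+ 2 = 4^-1 :> R); last by rewrite expr2; field.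
  rewrite exprVn ler_pdivlMr ?exprn_gt0// mulrC -lee_fin fineK//.
  have := @nneseries_lim_ge _ (w^~ x) xpredT 0%N n.+1 (fun n _ _ => w0 n x).
  apply: le_trans; rewrite big_mkord big_ord_recr/=.
  by rewrite leeDr// sume_ge0.
(* Multiplying by the indicator of Z makes the series converge everywhere, so
   that D is a pointwise limit of measurable functions. *)
pose a n (x : R) : R := \1_Z x * complex.Re (d n x).
pose b n (x : R) : R := \1_Z x * complex.Im (d n x).
have ReIm_le (z : R[i]) :
    `|complex.Re z| <= normc z /\ `|complex.Im z| <= normc z.
  by case: z => p q /=; rewrite -!sqrtr_sqr !ler_wsqrtr ?lerDl ?lerDr ?sqr_ge0.
have ab_le x n : `|a n x| <= Num.sqrt (gx x) * 2^-1 ^+ n /\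
    `|b n x| <= Num.sqrt (gx x) * 2^-1 ^+ n.
  rewrite /a /b indicE; case: (boolP (x \in Z)) => [/set_mem Zx|_].
    have [rd id] := ReIm_le (d n x); rewrite !mul1r.
    by split; [apply: le_trans rd _|apply: le_trans id _]; exact: d_le.
  by rewrite !mul0r normr0 mulr_ge0 ?sqrtr_ge0// exprn_ge0.
have {}a_lim x := geometric_dominated_series (fun n => (ab_le x n).1).
have {}b_lim x := geometric_dominated_series (fun n => (ab_le x n).2).
pose D (x : R) : R[i] := (limn (series (a^~ x))) +i* (limn (series (b^~ x))).
have mser (c : nat -> R -> R) : (forall n, measurable_fun setT (c n)) ->
    (forall x, cvgn (series (c^~ x))) ->
    measurable_fun setT (fun x => limn (series (c^~ x))).
  move=> mc cc.
  apply: (@measurable_fun_cvg _ _ _ setT (fun n x => series (c^~ x) n)).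
    by move=> n; exact: measurable_sum.
  by move=> x _; exact: cc.
have mD : measurable_fun setT (@complex.Re R \o D).
  apply: mser => [n|x]; last exact: (a_lim x).1.
  have /asboolP[mr _ _] := l2funP (d n).
  by apply: measurable_funM => //; exact: measurable_indic.
have mD' : measurable_fun setT (@complex.Im R \o D).
  apply: mser => [n|x]; last exact: (b_lim x).1.
  have /asboolP[_ mi _] := l2funP (d n).
  by apply: measurable_funM => //; exact: measurable_indic.
have sq_le (y z : R) : `|y| <= z -> y ^+ 2 <= z ^+ 2.
  move=> yz; rewrite -(real_normK (num_real y)) ler_sqr ?nnegrE//.
  exact: le_trans yz.
have tail x n (p q : R) : p = series (a^~ x) n -> q = series (b^~ x) n ->
    normc ((p +i* q) - D x) ^+ 2 <= 8 * 4^-1 ^+ n * gx x.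
  move=> -> ->; rewrite normc_sqr/=.
  rewrite (_ : _ * gx x = (2 * Num.sqrt (gx x) * 2^-1 ^+ n) ^+ 2 *+ 2).
    by rewrite mulr2n lerD//; apply: sq_le;
      [exact: (a_lim x).2|exact: (b_lim x).2].
  rewrite !exprMn sqr_sqrtr// -exprM mulnC exprM.
  rewrite (_ : 2^-1 ^+ 2 = 4^-1 :> R); last by rewrite expr2; field.
  ring.
have DL2 : D \in sqint.
  apply: (@sqint_le _ _ gx 8) => // x; have := tail x 0%N 0 0.
  have s0 (c : nat -> R) : series c 0%N = 0 by rewrite /series/= big_geq.
  rewrite !s0 => /(_ erefl erefl).
  rewrite expr0 mulr1; apply: le_trans.
  by rewrite !normc_sqr/= !sub0r !sqrrN.
exists (L2class (L2Fun DL2)) => e e0.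
pose I := fine (\int[mu]_x (gx x)%:E).
have I0 : 0 <= I by apply/fine_ge0/integral_ge0 => x _; rewrite lee_fin.
have dist_le n : sqnorm L2dot (\sum_(i < n) u i - L2class (L2Fun DL2)) <=
    8 * I * 4^-1 ^+ n.
  have -> : \sum_(i < n) u i - L2class (L2Fun DL2) =
      L2class (\sum_(i < n) d i - L2Fun DL2).
    rewrite raddfB raddf_sum; congr (_ - _); apply: eq_bigr => i _.
    by rewrite /d; exact/esym/L2repK.
  rewrite -lee_fin sqnorm_L2class.
  have -> : (8 * I * 4^-1 ^+ n)%:E = (\int[mu]_x (8 * 4^-1 ^+ n * gx x)%:E)%E.
    under eq_integral do rewrite EFinM.
    rewrite ge0_integralZl_EFin ?mulr_ge0 ?exprn_ge0//; last 2 first.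
    - by move=> x _; rewrite lee_fin.
    - by apply/measurable_EFinP; exact: mgx.
    rewrite -[in RHS](fineK (integrable_fin_num measurableT igx)) -EFinM -/I.
    by congr EFin; ring.
  apply: ae_ge0_le_integral => //.
  - by move=> x _; rewrite lee_fin sqr_ge0.
  - have /asboolP[mr mi _] := l2funP (\sum_(i < n) d i - L2Fun DL2).
    by apply/measurable_EFinP; exact: measurable_normc_sqr.
  - by move=> x _; rewrite lee_fin !mulr_ge0 ?exprn_ge0.
  - by apply/measurable_EFinP; exact: measurable_funM.
  apply: lebesgue_aeS aeZ => x Zx _; rewrite lee_fin.
  have -> : (\sum_(i < n) d i - L2Fun DL2) x = \sum_(i < n) d i x - D x.
    by rewrite -sum_L2fun.
  set z := \sum_(i < n) d i x.
  have -> : z = complex.Re z +i* complex.Im z by case: z.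
  apply: tail; rewrite /z raddf_sum /series/= big_mkord; apply: eq_bigr => i _.
    by rewrite /a indicE mem_set// mul1r.
  by rewrite /b indicE mem_set// mul1r.
have : (fun n => 8 * I * (4^-1 : R) ^+ n) @ \oo --> (0 : R).
  by apply: cvg_geometric; rewrite ger0_norm// invf_lt1// ltr1n.
move=> /cvgrPdist_lt /(_ _ e0)[N _ uN]; exists N => n /uN /=.
rewrite sub0r normrN; apply: le_lt_trans.
exact: le_trans (dist_le n) (ler_norm _).
Qed.

End L2_complete.

(** * Gabor systems *)

(** Enumerating a Gabor system by the integers keeps its linear relations. *)
Lemma has_sum_reindex (R : realType) (H : lmodType R[i])
    (dot : {dot H for @conjc R}) (I J : choiceType) (s : I -> J)
    (u : J -> H) (h : H) :
  bijective s -> has_sum dot u h -> has_sum dot (u \o s) h.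
Proof.
move=> [t sK tK] us e /us[F0 uF0]; exists (t @` F0)%fset => F F0F.
have /uF0 : (F0 `<=` s @` F)%fset.
  apply/fsubsetP => j jF0; apply/imfsetP; exists (t j); last by rewrite tK.
  by apply: (fsubsetP F0F); exact: in_imfset.
by rewrite big_imfset//= => i j _ _; exact: (can_inj sK).
Qed.

Lemma in_ell2_reindex (R : realType) (I J : choiceType) (s : I -> J)
    (c : J -> R[i]) : bijective s -> in_ell2 c -> in_ell2 (c \o s).
Proof.
move=> sbij; rewrite /in_ell2 (reindex_esum [set: I] [set: J] s)//.
by rewrite setTT_bijective.
Qed.

Lemma generated_byS (R : realType) (H : lmodType R[i]) (T : H -> H)
    (f : int -> H) : bijective T -> generated_by T f ->
  forall k, T (f k) = f (k + 1).
Proof.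
move=> [S TK SK] fT k; rewrite (fT k) (fT (k + 1)) !(opz_can TK SK).
case: k => [n|[|n]].
- by rewrite -PoszD addn1.
- by rewrite /= SK.
- rewrite (_ : Negz n.+1 + 1 = Negz n); first by rewrite iterS SK.
  by rewrite !NegzE -(addn1 n.+1) PoszD opprD subrK.
Qed.

Section gabor.
Context {R : realType}.
Local Notation mu := (@lebesgue_measure R).

(** The complement of the support is covered by countably many rational
    intervals on which f vanishes almost everywhere. *)
Lemma L2supp_ae (f : L2 R) : \forall x \ae mu, ~ L2supp f x -> L2rep f x = 0.
Proof.
pose good (r : rat * rat) :=
  \forall x \ae mu, ((ratr r.1 : R) < x < ratr r.2) -> L2rep f x = 0.
have : \forall x \ae mu, forall n : nat,
    if @choice.unpickle (rat * rat)%type n is Some r then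
    good r -> ((ratr r.1 : R) < x < ratr r.2) -> L2rep f x = 0 else True.
  apply: ae_foralln => n; case: (choice.unpickle n) => [r|]; last first.
    exact: lebesgue_aeW.
  have [gr|ngr] := pselect (good r).
    by apply: lebesgue_aeS gr => x fx _; exact: fx.
  exact: lebesgue_aeW.
apply: lebesgue_aeS => x fx /existsNP[U /not_implyP[Ux /contrapT Uf]].
have [e /= e0 eU] := Ux.
have [|p] := @rat_in_itvoo _ (x - e) x; first by rewrite gtrBl.
rewrite in_itv/= => /andP[ep px].
have [|q] := @rat_in_itvoo _ x (x + e); first by rewrite ltrDl.
rewrite in_itv/= => /andP[xq qe].
have := fx (choice.pickle (p, q)); rewrite choice.pickleK /= px xq; apply => //.
apply: lebesgue_aeS Uf => y Uy /andP[py yq]; apply/Uy/eU.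
by rewrite /= ltr_distlC; apply/andP; split; lra.
Qed.

Lemma L2class_eq0 (f : L2fun R) :
  L2class f = 0 <-> \forall x \ae mu, f x = 0.
Proof. by have := L2classE f 0; rewrite raddf0. Qed.

Lemma L2supp0 : L2supp (0 : L2 R) = set0.
Proof.
apply/seteqP; split=> // x /(_ setT filterT); apply.
by apply: lebesgue_aeS ((L2class_eq0 _).1 (L2repK 0)) => y ->.
Qed.

Lemma gabor_class (g : L2 R) a b m n : gabor g a b (m, n) =
  L2class (L2Fun (sqint_modul (m%:~R * b)
    (L2Fun (sqint_transl (n%:~R * a) (L2rep g))))).
Proof. by rewrite gaborE -[in LHS](L2repK g) transl_class modul_class. Qed.

(** The modulation factor has modulus 1, and a translation preserves null
    sets. *)
Lemma gabor_neq0 (g : L2 R) a b mn : g != 0 -> gabor g a b mn != 0.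
Proof.
case: mn => m n; apply: contra => /eqP; rewrite gabor_class.
move=> /L2class_eq0 /(ae_rshift (- (n%:~R * a))) g0.
apply/eqP; rewrite -(L2repK g); apply/L2class_eq0.
apply: lebesgue_aeS g0 => x /= /eqP; rewrite opprK addrK mulf_eq0.
case/orP => [/eqP e0|/eqP //].
have := normc_expi (2 * pi * (m%:~R * b) * (x + n%:~R * a)).
by rewrite e0 Normc.normc0 => /eqP; rewrite eq_sym oner_eq0.
Qed.

(** Up to a null set, the closed interval may be replaced by [c, c + a), whose
    translates by distinct multiples of a are disjoint. *)
Lemma gabor_orthogonal (g : L2 R) (a b c : R) (mn mn' : int * int) : 0 < a ->
  L2supp g `<=` `[c, c + a] -> mn.2 != mn'.2 ->
  L2dot (gabor g a b mn) (gabor g a b mn') = 0.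
Proof.
have lin (x u v : R) : c <= x - u -> x - v < c + a -> u < v + a by lra.
case: mn mn' => [m n] [m' n'] a0 gca /= nn'; rewrite !gabor_class L2dot_class.
have gae : \forall x \ae mu, L2rep g x != 0 -> c <= x < c + a.
  have : \forall x \ae mu, x != c + a.
    exists [set c + a]; split => //; first exact: lebesgue_measure_set1.
    by move=> x /= /negP; rewrite negbK => /eqP.
  move: (L2supp_ae g); apply: lebesgue_aeS2 => x gx xca gx0.
  have /gca /= : L2supp g x by apply: contrapT => /gx; exact/eqP.
  by rewrite in_itv/= le_eqVlt => /andP[-> ]; rewrite lt_neqAle xca.
have -> : 0 = Cintegral (fun _ : R => 0 : R[i]).
  by rewrite /Cintegral /= !Rintegral_cst// mul0r.
apply: ae_eq_Cintegral.
- by apply: sqint_conj_integrable; exact: l2funP.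
- by split; exact: integrable0.
apply: lebesgue_aeS2 (ae_rshift (n%:~R * a) gae) (ae_rshift (n'%:~R * a) gae).
move=> x /= gx gx'.
case: (eqVneq (L2rep g (x - n%:~R * a)) 0) => [->|/gx /andP[cx xc]].
  by rewrite mulr0 mul0r.
case: (eqVneq (L2rep g (x - n'%:~R * a)) 0) => [->|/gx' /andP[cx' xc']].
  by rewrite !mulr0 rmorph0 mulr0.
have lt1 (i j : int) : i%:~R * a < j%:~R * a + a -> i <= j.
  rewrite -[X in _ + X]mul1r -mulrDl ltr_pM2r// -[1]/(1%:~R) -intrD ltr_int.
  by rewrite ltzD1.
case/eqP: nn'; apply/eqP; rewrite eq_le; apply/andP; split; apply: lt1.
  exact: lin cx xc'.
exact: lin cx' xc.
Qed.

End gabor.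

Theorem corollary3p2 (R : realType) (g : L2 R) (a b c : R)
    (a_gt0 : 0 < a) (b_gt0 : 0 < b)
    (g_frame : overcomplete_frame L2dot (gabor g a b))
    (g_supp : L2supp g = `[c, c + a]%classic)
    (sigma : int -> int * int) (sigma_bij : bijective sigma) :
  ~ exists T : {linear L2 R -> L2 R},
      in_GL L2dot T /\ generated_by T (fun k => gabor g a b (sigma k)).
Proof.
move=> [T [[Tbd Tbij] gT]]; case: g_frame => gfr; apply; split=> // d [d2 d0] j.
have [B B0 gB] := frame_bessel gfr.
have [tau sigmaK tauK] := sigma_bij.
have fB : bessel L2dot (gabor g a b \o sigma) B.
  by apply: bessel_inj gB; exact: bij_inj.
have g0 : g != 0.
  apply/eqP => g0; have : `[c, c + a]%classic c.
    by rewrite /= in_itv/= lexx lerDl ltW.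
  by rewrite -g_supp g0 L2supp0.
rewrite -[j]tauK.
apply: (@orbit_riesz _ _ _ _ T B (@L2_fast_complete R) B0 fB Tbd (bij_inj Tbij)
  (generated_byS Tbij gT) (fun k => (sigma k).2) _ _ (d \o sigma) (tau j)).
- by move=> m; exists (tau (0, m)); rewrite tauK.
- move=> k l kl.
  rewrite -[LHS]/(L2dot (gabor g a b (sigma k)) (gabor g a b (sigma l))).
  by rewrite (@gabor_orthogonal _ g a b c _ _ a_gt0 _ kl) ?g_supp.
- exact: in_ell2_reindex.
- exact: (has_sum_reindex sigma_bij d0).
- exact: gabor_neq0.
Qed.
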